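(* If $G$ is a cubic Halin graph, then $G$ is $(1,2,2,2,2,2)$-packing colorable. That is, there is a partition of $V(G)$ into (possibly empty) sets $V_1,\dots,V_6$ such that any two distinct vertices of $V_1$ are at distance at least $2$ in $G$, and for each $2\le i\le 6$ any two distinct vertices of $V_i$ are at distance at least $3$ in $G$.
   Context: Graphs are finite and simple (no loops or multiple edges); $d_G(u,v)$ denotes the distance between $u$ and $v$ in $G$. For a non-decreasing sequence $S=(s_1,\dots,s_k)$ of positive integers, an $S$-packing coloring of a graph $G$ is a partition of $V(G)$ into $k$ subsets $V_1,\dots,V_k$ (some of which may be empty) such that for each $1\le i\le k$ any two distinct vertices $u,v\in V_i$ satisfy $d_G(u,v)\ge s_i+1$; $G$ is $S$-packing colorable if it has such a coloring. A Halin graph is a planar graph $G=T\cup C$ obtained from a tree $T$ of order at least four, in which each vertex has degree either one (a leaf) or at least $3$, by connecting the leaves of $T$ into a cycle $C$ (so $V(G)=V(T)$, $V(C)$ is exactly the set of leaves of $T$, and $E(G)=E(T)\cup E(C)$, with $G$ planar). A graph is cubic if every vertex has degree $3$. *)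

(* Defs.v *)
From HB Require Import structures.
From mathcomp Require Import all_boot all_order all_algebra.
From mathcomp Require Import all_classical all_reals all_analysis.
Set Implicit Arguments.
Unset Strict Implicit.
Unset Printing Implicit Defensive.
Import Order.TTheory GRing.Theory Num.Theory.
Import numFieldNormedType.Exports.
Local Open Scope classical_set_scope.
Local Open Scope ring_scope.

(* A graph on the vertex set V is given by its adjacency relation. *)
Definition simple_graph (V : finType) (e : rel V) : Prop :=
  symmetric e /\ irreflexive e.

Definition degree (V : finType) (e : rel V) (x : V) : nat :=
  #|[pred y | e x y]|.

Definition cubic (V : finType) (e : rel V) : Prop :=
  forall x, degree e x = 3%N.

(* The size condition excludes the [ucycle]s that are not cycles of a graph:
   the empty one and the traversal of a single edge back and forth. *)
Definition acyclic (V : finType) (e : rel V) : Prop :=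
  forall s : seq V, (2 < size s)%N -> ~ ucycle e s.

Definition tree (V : finType) (e : rel V) : Prop :=
  [/\ simple_graph e, (0 < #|V|)%N, forall x y, connect e x y & acyclic e].

Definition leaf (V : finType) (e : rel V) (x : V) : bool := degree e x == 1%N.

(* The edges of the cycle through the vertices of the duplicate-free sequence
   s, in this cyclic order.  The membership test is needed because
   [next s x = x] for x outside s. *)
Definition cycle_edge (V : finType) (s : seq V) : rel V := fun x y =>
  [&& x \in s, y \in s & (y == next s x) || (x == next s y)].

Definition plane_arc (R : realType) (x y : R * R) (A : set (R * R)) : Prop :=
  exists gamma : R -> R * R,
    [/\ {within `[0, 1], continuous gamma},
        {in `[0, 1] &, injective gamma},
        gamma 0 = x, gamma 1 = y & gamma @` `[0, 1] = A].

(* p places the vertices in the plane and A u v is the curve drawn for the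
   edge uv. *)
Definition plane_drawing (R : realType) (V : finType) (e : rel V)
    (p : V -> R * R) (A : V -> V -> set (R * R)) : Prop :=
  [/\ injective p,
      forall u v, e u v -> plane_arc (p u) (p v) (A u v) /\ A u v = A v u,
      forall u v w, e u v -> A u v (p w) -> w = u \/ w = v
    & forall u v u' v', e u v -> e u' v' ->
        (u, v) <> (u', v') -> (u, v) <> (v', u') ->
        forall z, A u v z -> A u' v' z ->
          exists2 w, z = p w & w \in [:: u; v] /\ w \in [:: u'; v']].

Definition planar (R : realType) (V : finType) (e : rel V) : Prop :=
  exists (p : V -> R * R) (A : V -> V -> set (R * R)), plane_drawing e p A.

Definition halin (R : realType) (V : finType) (e : rel V) : Prop :=
  exists (t : rel V) (s : seq V),
    [/\ [/\ tree t, (4 <= #|V|)%N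
          & forall x, degree t x = 1%N \/ (3 <= degree t x)%N],
        [/\ uniq s, (3 <= size s)%N & forall x, (x \in s) = leaf t x],
        forall x y, e x y = t x y || cycle_edge s x y
      & planar R e].

(* d is the distance between u and v; vertices in different components have
   no distance, i.e., are infinitely far apart. *)
Definition is_dist (V : finType) (e : rel V) (u v : V) (d : nat) : Prop :=
  (exists p, [/\ path e u p, last u p = v & size p = d]) /\
  (forall p, path e u p -> last u p = v -> (d <= size p)%N).

Definition dist_ge (V : finType) (e : rel V) (u v : V) (m : nat) : Prop :=
  forall d, is_dist e u v d -> (m <= d)%N.

(* S lists the s_i, and the parts P i are indexed from 0. *)
Definition packing_coloring (V : finType) (e : rel V) (S : seq nat)
    (P : 'I_(size S) -> {set V}) : Prop :=
  (forall x, exists! i, x \in P i) /\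
  (forall i u v, u \in P i -> v \in P i -> u <> v ->
     dist_ge e u v (nth 0%N S i + 1)%N).

Definition packing_colorable (V : finType) (e : rel V) (S : seq nat) : Prop :=
  exists P : 'I_(size S) -> {set V}, packing_coloring e P.

(* Main.v *)
Require Import Defs.
From mathcomp Require Import all_boot all_order all_algebra.
From mathcomp Require Import all_classical all_reals all_analysis.
From mathcomp Require Import zify lra.
Set Implicit Arguments.
Unset Strict Implicit.
Unset Printing Implicit Defensive.
Import Order.TTheory GRing.Theory Num.Theory.
Import numFieldNormedType.Exports.

(** Root the tree at a leaf [p0].  Deleting a tree edge leaves two subtrees, and
the one without [p0], a branch, meets the rest of the graph in three edges only:
one at its root and one at each end of its sequence of leaves.  This needs
planarity: in a plane drawing the leaves of a branch are consecutive on the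
cycle.  (The Petersen graph consists of a cubic tree with six leaves and a cycle
through them, and it has no such coloring.)

The coloring.  A packing coloring for (1,2,2,2,2,2) is a coloring by 0, ..., 5
such that, around every vertex, the nonzero colors in its closed neighborhood
are distinct and color 0 is not on both ends of an edge ([star]).  What the rest
of the graph can see of a colored branch is the pair of colors on each of its
three outgoing edges.  There is a set of such triples ([flexible]) that every
branch with at least two leaves can realize: a triple in this set, prescribed
on a branch, splits into prescriptions for the two branches hanging below its
root, each of which is again in the set, or is a legal coloring around a single
vertex if that smaller branch is a leaf.  This is a finite check
([flexible_joinable]).  The branch consisting of everything but [p0] therefore
has a coloring in which [p0] has color 0 and three neighbors of distinct nonzero
colors.

Planarity.  If the leaves of a branch were not consecutive, two leaves of the
branch and two leaves outside would alternate on the cycle.  With the two ends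
of the deleted tree edge they are the six vertices of a subdivided K_{3,3}: the
cycle contributes four paths, the tree the other five ([no_crossing]).  That
K_{3,3} is not planar is proved by counting turns.  Along each edge uv, measure
how much the direction from a fixed vertex w turns, in quarter turns.  If the
edges uv and wz have disjoint arcs, then the difference of a point on one and a
point on the other never vanishes, and the turns around the boundary of the
square of parameters add up to zero ([turning_system]).  These linear equations
extend to walks, and for the nine paths of a K_{3,3} they contradict each other
modulo 8 ([K33_parity]). *)

(** * Polygonal approximation of a plane drawing *)

Section Discretization.
Local Open Scope classical_set_scope.
Local Open Scope ring_scope.
Variable R : realType.
Implicit Types (x y : R * R).

Lemma small_positives (eta : R) : 0 < eta ->
  \forall d \near 0^'+, 0 < d < eta.
Proof.
move=> eta0; near=> d; apply/andP; split => //.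
Unshelve. all: by end_near. Qed.

Lemma arc_unif_continuous (gamma : R -> R * R) (eps : R) :
  {within `[0, 1], continuous gamma} -> 0 < eps ->
  exists2 delta : R, 0 < delta &
    forall a b, a \in `[0, 1] -> b \in `[0, 1] -> `|a - b| < delta ->
      ball (gamma a) eps (gamma b).
Proof.
move=> /subspace_continuousP gcont eps0.
have e2 : 0 < eps / 2 by rewrite divr_gt0.
pose P (d a : R) := a \in `[0, 1] -> forall b, b \in `[0, 1] ->
  `|a - b| < d -> ball (gamma a) eps (gamma b).
have /compact_near_coveringP cover := @segment_compact R 0 1.
have : \forall d \near 0^'+, `[0, 1] `<=` P d.
  apply: cover => x xI.
  have /= := gcont x xI _ (nbhsx_ballx (gamma x) _ e2).
  rewrite /within/= => /nbhs_ballP[eta /= eta0 near_x].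
  have eta2 : 0 < eta / 2 by rewrite divr_gt0.
  exists (ball x (eta / 2), [set d | 0 < d < eta / 2]).
    split; first exact: nbhsx_ballx.
    exact: small_positives.
  move=> [a d] /= [xa /andP[d0 de]] aI b bI abd.
  have /= ga : ball (gamma x) (eps / 2) (gamma a).
    by apply: near_x => //; apply: le_ball xa; lra.
  have /= gb : ball (gamma x) (eps / 2) (gamma b).
    apply: near_x => //; rewrite (splitr eta); apply: ball_triangle xa _.
    by rewrite /ball/=; lra.
  by rewrite (splitr eps); exact: ball_triangle (ball_sym ga) gb.
move=> near0P; have [|d [PI d0]] :=
  @filter_ex _ _ _ _ (filterI near0P (small_positives ltr01)).
  exact: at_right_proper_filter.
by case/andP: d0 => d0 _; exists d => // a b aI bI; apply: PI.
Qed.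

Lemma disjoint_compact_dist (K L : set (R * R)) :
  compact K -> compact L -> K `&` L = set0 ->
  exists2 delta : R, 0 < delta & forall x y, K x -> L y -> ~ ball x delta y.
Proof.
move=> /compact_near_coveringP cover cptL KL0.
pose P (d : R) x := forall y, L y -> ~ ball x d y.
have : \forall d \near 0^'+, K `<=` P d.
  apply: cover => x Kx.
  have Lcl : closed L by apply: compact_closed cptL; exact: norm_hausdorff.
  have nLx : (~` L) x by move=> Lx; suff : (K `&` L) x by rewrite KL0.
  have /nbhs_ballP[eta /= eta0 near_x] : nbhs x (~` L).
    by apply: open_nbhs_nbhs; split => //; rewrite openC.
  have eta2 : 0 < eta / 2 by rewrite divr_gt0.
  exists (ball x (eta / 2), [set d | 0 < d < eta / 2]).
    split; first exact: nbhsx_ballx.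
    exact: small_positives.
  move=> [a d] /= [xa /andP[d0 de]] y Ly ay.
  apply: (near_x y) => //; rewrite (splitr eta); apply: ball_triangle xa _.
  by apply: le_ball ay; exact: ltW.
move=> near0P; have [|d [PK d0]] :=
  @filter_ex _ _ _ _ (filterI near0P (small_positives ltr01)).
  exact: at_right_proper_filter.
by case/andP: d0 => d0 _; exists d => // a b /PK; apply.
Qed.

(** Finitely many conditions, each of which holds for all small enough positive
numbers, hold for a common one. *)
Lemma finite_positive_lower_bound (I : finType) (P : I -> R -> Prop) :
  (forall i d d', 0 < d' -> d' <= d -> P i d -> P i d') ->
  (forall i, exists2 d, 0 < d & P i d) ->
  exists2 d, 0 < d & forall i, P i d.
Proof.
move=> Pdec /(_ _)/cid2 /= d_; pose d i := s2val (d_ i).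
have dP i : 0 < d i /\ P i (d i).
  by split; [apply: (s2valP (d_ i))|apply: (s2valP' (d_ i))].
exists (\big[Num.min/1]_i d i) => [|i].
  by elim/big_ind: _ => // [x y x0 y0|i _]; [rewrite lt_min x0|case: (dP i)].
apply: Pdec (dP i).2; last exact: bigmin_le_cond.
by elim/big_ind: _ => // [x y x0 y0|j _]; [rewrite lt_min x0|case: (dP j)].
Qed.

Section Polygons.
Variables (V : finType) (e : rel V) (p : V -> R * R) (A : V -> V -> set (R * R)).
Hypothesis drawing : plane_drawing e p A.

(** The arcs of a drawing can be replaced by sequences of points so fine that
the jumps along any arc are shorter than the distance of any two arcs drawn for
edges without a common end. *)
Lemma polygonal_drawing : exists (d : R) (n : nat) (Q : V -> V -> nat -> R * R),
  [/\ 0 < d,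
      forall u v, e u v -> Q u v 0%N = p u /\ Q u v n = p v,
      forall u v i, e u v -> (i < n)%N -> ball (Q u v i) d (Q u v i.+1)
    & forall u v w z i j, e u v -> e w z -> ~~ has (mem [:: u; v]) [:: w; z] ->
        (i <= n)%N -> (j <= n)%N -> ~ ball (Q u v i) d (Q w z j)].
Proof.
case: drawing => _ Aarc _ Across.
have Acpt u v : e u v -> compact (A u v).
  move=> /Aarc[[g [gcont _ _ _ <-]] _].
  exact: continuous_compact gcont (@segment_compact R 0 1).
have [d d0 dP] : exists2 d : R, 0 < d & forall uvwz : (V * V) * (V * V),
    let: ((u, v), (w, z)) := uvwz in
    e u v -> e w z -> ~~ has (mem [:: u; v]) [:: w; z] ->
    forall x y, A u v x -> A w z y -> ~ ball x d y.
  apply: finite_positive_lower_bound => [[[u v] [w z]] d d' _ dd' H|[[u v] [w z]]].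
    move=> euv ewz dis x y xA yA xy.
    by apply: (H euv ewz dis _ _ xA yA); exact: le_ball xy.
  have [euv|] := boolP (e u v); last by exists 1.
  have [ewz|] := boolP (e w z); last by exists 1.
  have [dis|] := boolP (~~ has (mem [:: u; v]) [:: w; z]); last by exists 1.
  have [|d d0 dP] := disjoint_compact_dist (Acpt _ _ euv) (Acpt _ _ ewz).
    rewrite -subset0 => x /= [xA xA'].
    have dif a b : [:: a; b] =i [:: w; z] -> (u, v) <> (a, b).
      move=> ab [uE vE]; move/hasPn: dis => /(_ a); rewrite -ab mem_head => /(_ isT) /=.
      by rewrite -uE mem_head.
    have [||y _ []] := Across _ _ _ _ euv ewz _ _ x xA xA'.
    - exact: dif.
    - by apply: dif => y; rewrite !inE orbC.
    - by move=> yuv /(hasPn dis) /=; rewrite yuv.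
  by exists d.
have /choice[g gP] : forall uv : V * V, exists g : R -> R * R, e uv.1 uv.2 ->
    [/\ {within `[0, 1], continuous g}, g 0 = p uv.1, g 1 = p uv.2
       & g @` `[0, 1] = A uv.1 uv.2].
  move=> [u v] /=; have [euv|] := boolP (e u v); last by exists (fun=> 0).
  by have [[g [gc _ g0 g1 gA]] _] := Aarc _ _ euv; exists g.
have [delta delta0 deltaP] : exists2 delta : R, 0 < delta &
    forall uv : V * V, e uv.1 uv.2 -> forall a b,
      a \in `[0, 1] -> b \in `[0, 1] -> `|a - b| < delta -> ball (g uv a) d (g uv b).
  apply: finite_positive_lower_bound => [uv t t' _ tt' H euv a b aI bI ab|uv].
    by apply: H => //; exact: lt_le_trans ab tt'.
  have [/gP[gc _ _ _]|] := boolP (e uv.1 uv.2); last by exists 1.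
  by have [t t0 tP] := arc_unif_continuous gc d0; exists t.
have [n nP] : exists n : nat, n.+1%:R^-1 < delta.
  by have [n] := ltr_add_invr delta0; rewrite add0r; exists n.
pose tau i : R := i%:R / n.+1%:R.
have tau0 : tau 0%N = 0 by rewrite /tau mul0r.
have tauN : tau n.+1 = 1 by rewrite /tau divff ?pnatr_eq0.
have tauI i : (i <= n.+1)%N -> tau i \in `[0, 1].
  move=> iN; rewrite in_itv /= divr_ge0 ?ler0n //=.
  by rewrite ler_pdivrMr ?ltr0n // mul1r ler_nat.
have tauS i : `|tau i - tau i.+1| < delta.
  by rewrite distrC /tau -mulrBl -natrB ?leqnSn // subSnn mul1r ger0_norm.
pose Q u v i := g (u, v) (tau i).
have QA u v i : e u v -> (i <= n.+1)%N -> A u v (Q u v i).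
  move=> euv iN; have [_ _ _ /= <-] := gP _ (euv : e (u, v).1 (u, v).2).
  by exists (tau i) => //; exact: tauI.
exists d, n.+1, Q; split => //.
- move=> u v euv; have [_ /= guv0 guv1 _] := gP (u, v) euv.
  by rewrite /Q tau0 tauN.
- by move=> u v i euv iN; apply: (deltaP (u, v)) => //; rewrite tauI // ltnW.
move=> u v w z i j euv ewz dis iN jN.
by apply: (dP ((u, v), (w, z)) euv ewz dis (Q u v i) (Q w z j)); exact: QA.
Qed.
End Polygons.
End Discretization.


(** * Turning numbers of a plane drawing *)

Section Turning.
Local Open Scope classical_set_scope.
Local Open Scope ring_scope.
Variable R : realType.
Implicit Types (x y : R * R) (a b c : int).

(** The four quadrants between the diagonals, each with one of its two boundary
rays, so that for nonzero [x] the sector of [- x] is the opposite one. *)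
Definition sector x : int :=
  if - x.1 < x.2 <= x.1 then 0 else
  if - x.2 <= x.1 < x.2 then 1 else
  if x.1 <= x.2 < - x.1 then 2 else 3.

(** For sectors [a] and [b], the representative of [b - a] modulo 4 of least absolute
value: the turn that a short step makes from the one to the other. *)
Definition quarter_turns a b : int :=
  let c := b - a in if c == 3 then -1 else if c == - 3 then 1 else c.

Lemma sector_bounds x : 0 <= sector x <= 3.
Proof. by rewrite /sector; do !case: ifP => // _. Qed.

Lemma sectorP x : x <> 0 ->
  [\/ sector x = 0 /\ - x.1 < x.2 <= x.1, sector x = 1 /\ - x.2 <= x.1 < x.2,
      sector x = 2 /\ x.1 <= x.2 < - x.1 | sector x = 3 /\ x.2 < x.1 <= - x.2].
Proof.
move: x => [x1 x2] x0; rewrite /sector /=.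
case: ifP => [|/negbT/nandP h0]; first by constructor.
case: ifP => [|/negbT/nandP h1]; first by constructor.
case: ifP => [|/negbT/nandP h2]; first by constructor.
constructor; split => //; apply/andP; move: h0 h1 h2.
rewrite -!leNgt -!ltNge => h0 h1 h2.
case: h0 => ?; case: h1 => ?; case: h2 => ?; split; try lra;
  rewrite ltNge ?negbK -?leNgt //=; apply/negP => ?; apply: x0; congr (_, _); lra.
Qed.

Lemma sectorN x : x <> 0 -> sector (- x) = sector x + 2 \/ sector (- x) = sector x - 2.
Proof.
move=> x0; have xN0 : - x <> 0 by move=> /(congr1 -%R); rewrite opprK oppr0.
case: (sectorP x0) => -[-> /andP[? ?]]; case: (sectorP xN0) => /= -[-> /andP[? ?]];
  try (by [left|right]); exfalso; clear x0 xN0; lra.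
Qed.

Definition opposite a b := (a - b == 2) || (b - a == 2).

(** In sectors 0 and 2 the first coordinate is the one of largest absolute value,
with opposite signs; in sectors 1 and 3 it is the second. *)
Lemma opposite_sectors_far x y (d : R) :
  0 < d -> ~ ball x d 0 -> ~ ball y d 0 ->
  opposite (sector x) (sector y) -> ~ ball x (d + d) y.
Proof.
have nonzero (z : R * R) : ~ ball z d 0 -> 0 < d -> z <> 0.
  by move=> zd d0 z0; apply: zd; rewrite z0; exact: ballxx.
move: x y => [x1 x2] [y1 y2] d0 xd yd opp [/= xy1 xy2].
have x0 := nonzero _ xd d0; have y0 := nonzero _ yd d0.
have {}xd : d <= `|x1| \/ d <= `|x2|.
  case: (lerP d `|x1|) => [|h1]; first by left.
  case: (lerP d `|x2|) => [|h2]; first by right.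
  by case: xd; split; rewrite /ball /= subr0.
have {}yd : d <= `|y1| \/ d <= `|y2|.
  case: (lerP d `|y1|) => [|h1]; first by left.
  case: (lerP d `|y2|) => [|h2]; first by right.
  by case: yd; split; rewrite /ball /= subr0.
move: xy1 xy2; rewrite /ball /= !ltr_norml => /andP[? ?] /andP[? ?].
move: opp; rewrite /opposite; case: (sectorP x0) => /= -[-> /andP[? ?]];
  case: (sectorP y0) => /= -[-> /andP[? ?]] //= _;
  case: xd; case: yd; rewrite !ler_normr => /orP[?|?] /orP[?|?]; clear x0 y0; lra.
Qed.

Lemma quarter_turns_mod4 a b : exists k, quarter_turns a b = b - a + 4 * k.
Proof.
rewrite /quarter_turns; case: ifP => [/eqP ->|_]; first by exists (-1).
by case: ifP => [/eqP ->|_]; [exists 1|exists 0; rewrite mulr0 addr0].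
Qed.

Lemma four_values a : 0 <= a <= 3 -> [\/ a = 0, a = 1, a = 2 | a = 3].
Proof. by case: a => [[|[|[|[|a]]]]|a] //= _; constructor. Qed.

(** Sectors of which no two are opposite are all among two neighboring ones, where
turns are plain differences. *)
Lemma quarter_turns_square a b c d :
  0 <= a <= 3 -> 0 <= b <= 3 -> 0 <= c <= 3 -> 0 <= d <= 3 ->
  ~~ opposite a b -> ~~ opposite a c -> ~~ opposite a d ->
  ~~ opposite b c -> ~~ opposite b d -> ~~ opposite c d ->
  quarter_turns a b + quarter_turns b d = quarter_turns a c + quarter_turns c d.
Proof. by do 4 move=> /four_values[] ->. Qed.

Lemma quarter_turnsN x y : x <> 0 -> y <> 0 -> ~~ opposite (sector x) (sector y) ->
  quarter_turns (sector (- x)) (sector (- y)) = quarter_turns (sector x) (sector y).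
Proof.
move=> x0 y0.
move: (sectorN x0) (sectorN y0) (sector_bounds (- x)) (sector_bounds (- y)).
by case/four_values: (sector_bounds x) => ->; case/four_values: (sector_bounds y) => ->;
  case=> -> //; case=> ->.
Qed.

(** A discrete form of Green's theorem: if the circulation around each cell of a
grid vanishes, so does the circulation around the grid. *)
Lemma boundary_of_cells (n m : nat) (H W : nat -> nat -> int) :
  (forall i j, (i < n)%N -> (j < m)%N -> H i j + W i.+1 j = W i j + H i j.+1) ->
  \sum_(0 <= i < n) H i 0%N + \sum_(0 <= j < m) W n j =
  \sum_(0 <= j < m) W 0%N j + \sum_(0 <= i < n) H i m.
Proof.
elim: n => [|n IHn] cell; first by rewrite !(big_geq (leqnn 0)) add0r addr0.
rewrite !big_nat_recr //=.
have strip : H n 0%N + \sum_(0 <= j < m) W n.+1 j = \sum_(0 <= j < m) W n j + H n m.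
  have: forall j, (j < m)%N -> H n j + W n.+1 j = W n j + H n j.+1.
    by move=> j jm; apply: cell.
  elim: (m) => [|k IHk] cell'; first by rewrite !(big_geq (leqnn 0)) addr0 add0r.
  rewrite !big_nat_recr //= addrA IHk => [|j jk]; last by apply: cell'; exact: ltnW.
  by rewrite -!addrA cell'.
rewrite -addrA strip addrA IHn ?addrA // => i j iN jm; apply: cell => //; exact: ltnW.
Qed.

(** All that is kept of a plane drawing: [alpha u w] is the direction of [u] seen
from [w], and [T u v w] is how much the direction from [w] turns along the edge
[uv], both in quarter turns.  The last condition goes around the rectangle of
pairs of a point of [uv] and a point of [wz]. *)
Definition turning_system (V : finType) (e : rel V)
    (alpha : V -> V -> int) (T : V -> V -> V -> int) :=
  [/\ forall u w, u <> w -> exists k, alpha w u = alpha u w + 2 + 4 * k,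
      forall u v w, e u v -> exists k, T u v w = alpha v w - alpha u w + 4 * k
    & forall u v w z, e u v -> e w z -> ~~ has (mem [:: u; v]) [:: w; z] ->
        T u v w + T w z v = T w z u + T u v z].

Lemma drawing_turning_system (V : finType) (e : rel V) (p : V -> R * R)
    (A : V -> V -> set (R * R)) :
  plane_drawing e p A -> exists alpha T, turning_system e alpha T.
Proof.
move=> drawing; have [p_inj _ _ _] := drawing.
have [d [n [Q [d0 Qends Qstep QQ]]]] := polygonal_drawing drawing.
pose alpha u w := sector (p u - p w).
pose T u v w := \sum_(0 <= i < n)
  quarter_turns (sector (Q u v i - p w)) (sector (Q u v i.+1 - p w)).
exists alpha, T; split.
- move=> u w uw; have pupw : p u - p w <> 0 by move/eqP; rewrite subr_eq0 => /eqP/p_inj.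
  rewrite /alpha -opprB; case: (sectorN pupw) => ->.
    by exists 0; rewrite mulr0 addr0.
  by exists (-1); rewrite -addrA.
- move=> u v w euv; have [Q0 Qn] := Qends _ _ euv.
  rewrite /alpha -Q0 -Qn /T; elim: (n) => [|k [c IHk]].
    by exists 0; rewrite big_geq // subrr mulr0.
  rewrite big_nat_recr //= IHk.
  have [c' ->] :=
    quarter_turns_mod4 (sector (Q u v k - p w)) (sector (Q u v k.+1 - p w)).
  by exists (c + c'); lia.
move=> u v w z euv ewz dis.
have [Qu Qv] := Qends _ _ euv; have [Qw Qz] := Qends _ _ ewz.
pose L i j := Q u v i - Q w z j.
have shift (x y c : R * R) r : ball x r y -> ball (x - c) r (y - c).
  by move=> [? ?]; split; rewrite /ball /= opprB addrA subrK.
have reflect (x y c : R * R) r : ball x r y -> ball (c - x) r (c - y).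
  by move=> [? ?]; split; rewrite /ball /= opprB addrC addrA subrK distrC.
have far i j : (i <= n)%N -> (j <= n)%N -> ~ ball (L i j) d 0.
  move=> iN jn Lij; apply: (QQ u v w z i j) => //.
  by have := shift _ _ (- Q w z j) _ Lij; rewrite /L !opprK subrK add0r.
have near i j i' j' : (i' = i \/ i' = i.+1) -> (j' = j \/ j' = j.+1 \/ j = j'.+1) ->
    (i <= n)%N -> (i' <= n)%N -> (j <= n)%N -> (j' <= n)%N ->
    ball (L i j) (d + d) (L i' j').
  move=> ii jj iN iN' jN jN'; apply: (@ball_triangle _ _ (L i' j)).
    apply: shift; case: ii iN' => -> iN'; [exact: ballxx|exact: Qstep].
  apply: reflect; case: jj jN jN' => [->|[->|->]] jN jN'; first exact: ballxx.
    exact: Qstep.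
  by apply: ball_sym; exact: Qstep.
have no_opp i j i' j' : (i' = i \/ i' = i.+1) -> (j' = j \/ j' = j.+1 \/ j = j'.+1) ->
    (i <= n)%N -> (i' <= n)%N -> (j <= n)%N -> (j' <= n)%N ->
    ~~ opposite (sector (L i j)) (sector (L i' j')).
  move=> ii jj iN iN' jN jN'; apply/negP => opp.
  have LL := near _ _ _ _ ii jj iN iN' jN jN'.
  exact: opposite_sectors_far d0 (far _ _ iN jN) (far _ _ iN' jN') opp LL.
have nonzero i j : (i <= n)%N -> (j <= n)%N -> L i j <> 0.
  by move=> iN jN L0; apply: (far _ _ iN jN); rewrite L0; exact: ballxx.
pose H i j := quarter_turns (sector (L i j)) (sector (L i.+1 j)).
pose W i j := quarter_turns (sector (L i j)) (sector (L i j.+1)).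
(* Along the second edge [L] points from [z] to [w]: all sectors are opposite to
   those in [T], which leaves the turns unchanged. *)
have WT i (c : V) : (i <= n)%N -> p c = Q u v i -> \sum_(0 <= j < n) W i j = T w z c.
  move=> iN pc; apply: eq_big_nat => j /andP[_ jN].
  rewrite pc -[in RHS]opprB -[in X in quarter_turns _ X]opprB quarter_turnsN //.
  - apply: nonzero => //; exact: ltnW.
  - exact: nonzero.
  - apply: no_opp; rewrite ?(ltnW jN) //; [by left|by right; left].
have HT j (c : V) : p c = Q w z j -> \sum_(0 <= i < n) H i j = T u v c.
  by move=> pc; apply: eq_bigr => i _; rewrite pc.
have := @boundary_of_cells n n H W.
rewrite (HT 0%N w) // (HT n z) // (WT n v) // (WT 0%N u) //; apply => i j iN jN.
have [iN' jN'] := (ltnW iN, ltnW jN).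
(* The four corners of a cell are pairwise closer than [d + d]. *)
apply: (quarter_turns_square (sector_bounds _) (sector_bounds _)
                             (sector_bounds _) (sector_bounds _)).
all: try (by apply: no_opp => //; auto).
by rewrite /opposite orbC; apply: no_opp => //; auto.
Qed.
End Turning.

(** * The turning equations of a K_{3,3} *)

(** Vertices 0, 1, 2 against 3, 4, 5.  After substitution of the first two
hypotheses, the values of [a] cancel, and the sum of the 18 equations for
disjoint edges has the form [8 * k = 4]: the coefficients of the unknown multiples
of 4 are even, and the half turns 2 add up to an odd multiple of 4. *)
Lemma K33_parity (W : nat -> nat -> nat -> int) (a : nat -> nat -> int) :
  (forall u w, (u < w < 6)%N -> exists k, a w u = a u w + 2 + 4 * k)%R ->
  (forall i j w, (i < 3)%N -> (j < 3)%N -> (w < 6)%N ->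
     exists k, W i j w = a j.+3 w - a i w + 4 * k)%R ->
  (forall i j i' j', (i < i' < 3)%N -> (j < 3)%N -> (j' < 3)%N -> j != j' ->
     W i j i' + W i' j' j.+3 = W i' j' i + W i j j'.+3)%R ->
  False.
Proof.
move=> anti mod4 square.
have [k01 E01] := anti 0%N 1%N isT. have [k02 E02] := anti 0%N 2%N isT.
have [k03 E03] := anti 0%N 3%N isT. have [k04 E04] := anti 0%N 4%N isT.
have [k05 E05] := anti 0%N 5%N isT. have [k12 E12] := anti 1%N 2%N isT.
have [k13 E13] := anti 1%N 3%N isT. have [k14 E14] := anti 1%N 4%N isT.
have [k15 E15] := anti 1%N 5%N isT. have [k23 E23] := anti 2%N 3%N isT.
have [k24 E24] := anti 2%N 4%N isT. have [k25 E25] := anti 2%N 5%N isT.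
have [k34 E34] := anti 3%N 4%N isT. have [k35 E35] := anti 3%N 5%N isT.
have [k45 E45] := anti 4%N 5%N isT.
have [m001 M001] := mod4 0%N 0%N 1%N isT isT isT.
have [m002 M002] := mod4 0%N 0%N 2%N isT isT isT.
have [m004 M004] := mod4 0%N 0%N 4%N isT isT isT.
have [m005 M005] := mod4 0%N 0%N 5%N isT isT isT.
have [m011 M011] := mod4 0%N 1%N 1%N isT isT isT.
have [m012 M012] := mod4 0%N 1%N 2%N isT isT isT.
have [m013 M013] := mod4 0%N 1%N 3%N isT isT isT.
have [m015 M015] := mod4 0%N 1%N 5%N isT isT isT.
have [m021 M021] := mod4 0%N 2%N 1%N isT isT isT.
have [m022 M022] := mod4 0%N 2%N 2%N isT isT isT.
have [m023 M023] := mod4 0%N 2%N 3%N isT isT isT.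
have [m024 M024] := mod4 0%N 2%N 4%N isT isT isT.
have [m100 M100] := mod4 1%N 0%N 0%N isT isT isT.
have [m102 M102] := mod4 1%N 0%N 2%N isT isT isT.
have [m104 M104] := mod4 1%N 0%N 4%N isT isT isT.
have [m105 M105] := mod4 1%N 0%N 5%N isT isT isT.
have [m110 M110] := mod4 1%N 1%N 0%N isT isT isT.
have [m112 M112] := mod4 1%N 1%N 2%N isT isT isT.
have [m113 M113] := mod4 1%N 1%N 3%N isT isT isT.
have [m115 M115] := mod4 1%N 1%N 5%N isT isT isT.
have [m120 M120] := mod4 1%N 2%N 0%N isT isT isT.
have [m122 M122] := mod4 1%N 2%N 2%N isT isT isT.
have [m123 M123] := mod4 1%N 2%N 3%N isT isT isT.
have [m124 M124] := mod4 1%N 2%N 4%N isT isT isT.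
have [m200 M200] := mod4 2%N 0%N 0%N isT isT isT.
have [m201 M201] := mod4 2%N 0%N 1%N isT isT isT.
have [m204 M204] := mod4 2%N 0%N 4%N isT isT isT.
have [m205 M205] := mod4 2%N 0%N 5%N isT isT isT.
have [m210 M210] := mod4 2%N 1%N 0%N isT isT isT.
have [m211 M211] := mod4 2%N 1%N 1%N isT isT isT.
have [m213 M213] := mod4 2%N 1%N 3%N isT isT isT.
have [m215 M215] := mod4 2%N 1%N 5%N isT isT isT.
have [m220 M220] := mod4 2%N 2%N 0%N isT isT isT.
have [m221 M221] := mod4 2%N 2%N 1%N isT isT isT.
have [m223 M223] := mod4 2%N 2%N 3%N isT isT isT.
have [m224 M224] := mod4 2%N 2%N 4%N isT isT isT.
have S0011 := square 0%N 0%N 1%N 1%N isT isT isT isT.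
have S0012 := square 0%N 0%N 1%N 2%N isT isT isT isT.
have S0110 := square 0%N 1%N 1%N 0%N isT isT isT isT.
have S0112 := square 0%N 1%N 1%N 2%N isT isT isT isT.
have S0210 := square 0%N 2%N 1%N 0%N isT isT isT isT.
have S0211 := square 0%N 2%N 1%N 1%N isT isT isT isT.
have S0021 := square 0%N 0%N 2%N 1%N isT isT isT isT.
have S0022 := square 0%N 0%N 2%N 2%N isT isT isT isT.
have S0120 := square 0%N 1%N 2%N 0%N isT isT isT isT.
have S0122 := square 0%N 1%N 2%N 2%N isT isT isT isT.
have S0220 := square 0%N 2%N 2%N 0%N isT isT isT isT.
have S0221 := square 0%N 2%N 2%N 1%N isT isT isT isT.
have S1021 := square 1%N 0%N 2%N 1%N isT isT isT isT.
have S1022 := square 1%N 0%N 2%N 2%N isT isT isT isT.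
have S1120 := square 1%N 1%N 2%N 0%N isT isT isT isT.
have S1122 := square 1%N 1%N 2%N 2%N isT isT isT isT.
have S1220 := square 1%N 2%N 2%N 0%N isT isT isT isT.
have S1221 := square 1%N 2%N 2%N 1%N isT isT isT isT.
by clear anti mod4 square; lia.
Qed.

Section Walks.
Local Open Scope ring_scope.
Variables (V : finType) (e : rel V).
Variables (alpha : V -> V -> int) (T : V -> V -> V -> int).
Hypothesis ts : turning_system e alpha T.

Fixpoint walk_turn x p w : int :=
  if p is y :: p' then T x y w + walk_turn y p' w else 0.

Lemma walk_turn_mod4 x p w : path e x p ->
  exists k, walk_turn x p w = alpha (last x p) w - alpha x w + 4 * k.
Proof.
case: ts => _ mod4 _; elim: p x => [|y p IHp] x /=.
  by exists 0; rewrite subrr mulr0.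
case/andP=> exy /IHp[k ->]; have [k' ->] := mod4 x y w exy.
by exists (k + k'); lia.
Qed.

(** The rectangle of two walks is tiled by the rectangles of their edges. *)
Lemma walk_turn_square x p y q :
  path e x p -> path e y q -> ~~ has (mem (x :: p)) (y :: q) ->
  walk_turn x p y + walk_turn y q (last x p) =
  walk_turn y q x + walk_turn x p (last y q).
Proof.
case: ts => _ _ square.
have edge u v y' : e u v -> path e y' q -> ~~ has (mem [:: u; v]) (y' :: q) ->
    T u v y' + walk_turn y' q v = walk_turn y' q u + T u v (last y' q).
  move=> euv; elim: (q) y' => [|z q' IHq] y' /=; first by rewrite addr0 add0r.
  case/andP=> ey'z pq'; rewrite !(inE, negb_or) => /and3P[ny nz nq'].
  have := IHq z pq'; rewrite /= !(inE, negb_or) nz => /(_ nq').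
  have := square u v y' z euv ey'z; rewrite /= !(inE, negb_or) ny nz => /(_ isT).
  lia.
move=> + pq; elim: p x => [|x' p IHp] x; first by rewrite /= add0r addr0.
rewrite [path _ _ _]/= => /andP[exx' px'] dis.
have dis1 : ~~ has (mem (x' :: p)) (y :: q).
  by apply: contra dis => /hasP[v vq vp]; apply/hasP; exists v => //; apply/orP; right.
have dis2 : ~~ has (mem [:: x; x']) (y :: q).
  apply: contra dis => /hasP[v vq]; rewrite !inE => /orP vx.
  by apply/hasP; exists v; rewrite // !inE; case: vx => ->; rewrite ?orbT.
rewrite /=; have := IHp x' px' dis1; have := edge x x' y exx' pq dis2; lia.
Qed.

Lemma K33_no_turning (X Y : 'I_3 -> V) (P : 'I_3 -> 'I_3 -> seq V) :
  (forall i j, path e (X i) (P i j) /\ last (X i) (P i j) = Y j) ->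
  (forall i i' j j', i != i' -> j != j' ->
     ~~ has (mem (X i :: P i j)) (X i' :: P i' j')) ->
  False.
Proof.
move=> PP dis; case: (ts) => anti _ _.
have starts i j : X i \in X i :: P i j by rewrite mem_head.
have ends i j : Y j \in X i :: P i j by have [_ <-] := PP i j; exact: mem_last.
have other (i : 'I_3) : exists j, i != j.
  exists (inord (i == 0%N :> nat)); apply/eqP => /(congr1 val) /=.
  by rewrite inordK; case: (val i) => [|[|]].
have neq i i' j j' v w : i != i' -> j != j' ->
    v \in X i :: P i j -> w \in X i' :: P i' j' -> v <> w.
  move=> ii jj vP wP vw; move/hasPn: (dis _ _ _ _ ii jj) => /(_ _ wP).
  by rewrite -vw => /negP; apply.
pose x k : V := if (k < 3)%N then X (inord k) else Y (inord (k - 3)%N).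
have xX k : (k < 3)%N -> x k = X (inord k) by rewrite /x => ->.
have xY k : x k.+3 = Y (inord k) by rewrite /x !subSS subn0.
have inord_neq i j : (i < 3)%N -> (j < 3)%N -> i != j -> inord i != inord j :> 'I_3.
  by move=> i3 j3; apply: contra => /eqP/(congr1 val) /=; rewrite !inordK // => ->.
apply: (@K33_parity
  (fun i j k => walk_turn (X (inord i)) (P (inord i) (inord j)) (x k))
  (fun k l => alpha (x k) (x l))).
- move=> u w /andP[uw w6]; apply: anti.
  have [w3|w3] := ltnP w 3.
    have u3 := ltn_trans uw w3; rewrite !xX //.
    have [j jj] := other ord0.
    have uw' : inord u != inord w :> 'I_3 by apply: inord_neq; rewrite // neq_ltn uw.
    exact: (neq _ _ _ _ _ _ uw' jj (starts _ _) (starts _ _)).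
  have w'3 : (w - 3 < 3)%N by rewrite ltn_subLR.
  rewrite -(subnK w3) addn3 xY; have [u3|u3] := ltnP u 3.
    have [i ii] := other (inord u); have [j jj] := other (inord (w - 3)).
    rewrite xX // => uw'.
    apply: (neq (inord u) i j (inord (w - 3)) _ _ ii _ (starts _ _) (ends _ _) uw').
    by rewrite eq_sym.
  have [i ii] := other ord0; rewrite -(subnK u3) addn3 xY.
  have uw' : inord (u - 3) != inord (w - 3) :> 'I_3.
    by apply: inord_neq; lia.
  exact: (neq _ _ _ _ _ _ ii uw' (ends _ _) (ends _ _)).
- move=> i j w i3 j3 w6; have [pP eP] := PP (inord i) (inord j).
  have [k ->] := walk_turn_mod4 (x w) pP.
  by exists k; rewrite eP xY (xX i).
move=> i j i' j' /andP[ii i3] j3 j3' jj; have [pP eP] := PP (inord i) (inord j).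
have [pP' eP'] := PP (inord i') (inord j').
have ii' : inord i != inord i' :> 'I_3 by apply: inord_neq; lia.
have := walk_turn_square pP pP' (dis _ _ _ _ ii' (inord_neq _ _ j3 j3' jj)).
by rewrite eP eP' !xY !xX // (ltn_trans ii).
Qed.


(** Carrying a set around the walk makes disjointness of walks a matter of sets. *)
Definition linked (S : pred V) (x y : V) :=
  exists p, [/\ path e x p, last x p = y & all S (x :: p)].

Lemma linked_sym (S : pred V) x y : symmetric e -> linked S x y -> linked S y x.
Proof.
move=> e_sym [p [pp <- aS]]; exists (rev (belast x p)); split.
- by rewrite rev_path; apply: sub_path pp => u v; rewrite e_sym.
- by case: (p) => //= z p'; rewrite rev_cons last_rcons.
by rewrite -rev_rcons -lastI all_rev.
Qed.

Lemma no_K33 (S : 'I_3 -> 'I_3 -> pred V) (X Y : 'I_3 -> V) :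
  (forall i j, linked (S i j) (X i) (Y j)) ->
  (forall i i' j j', i != i' -> j != j' -> forall v, S i j v -> S i' j' v -> False) ->
  False.
Proof.
move=> link dis.
have /fin_all_exists[P PP] : forall ij : 'I_3 * 'I_3, exists p,
   [/\ path e (X ij.1) p, last (X ij.1) p = Y ij.2 & all (S ij.1 ij.2) (X ij.1 :: p)].
  by move=> [i j]; exact: link.
apply: (K33_no_turning (X := X) (Y := Y) (P := fun i j => P (i, j))).
  by move=> i j; case: (PP (i, j)).
move=> i i' j j' ii jj; apply/hasPn => v /= vP'; apply/negP => vP.
have [_ _ /allP/(_ v vP)] := PP (i, j); have [_ _ /allP/(_ v vP')] := PP (i', j').
by move=> /= S' S1; exact: dis ii jj v S1 S'.
Qed.
End Walks.

(** * Branches of a tree *)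

Section Branches.
Variables (V : finType) (t : rel V).
Hypothesis tree_t : tree t.
Implicit Types q x y z u v w : V.

Lemma tree_sym : symmetric t. Proof. by case: tree_t => [[]]. Qed.
Lemma tree_irr : irreflexive t. Proof. by case: tree_t => [[]]. Qed.

Definition avoiding q : rel V := fun u v => [&& t u v, u != q & v != q].

(** For adjacent [q] and [x], the component of [x] once the edge [qx] is deleted. *)
Definition branch q x : pred V := connect (avoiding q) x.

Lemma path_avoiding q x p : x != q -> path (avoiding q) x p = path t x p && (q \notin p).
Proof.
elim: p x => //= y p IHp x xq; rewrite inE negb_or /avoiding xq /=.
have [yq|yq] := eqVneq y q; first by rewrite !andbF.
by rewrite IHp // andbT andbA.
Qed.

Lemma branch_path q x w : branch q x w ->
  exists p, [/\ path (avoiding q) x p, uniq (x :: p) & last x p = w].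
Proof. by case/connectP=> p + ->; case/shortenP=> p' *; exists p'. Qed.

Lemma path_branch q x p w : path (avoiding q) x p -> last x p = w -> branch q x w.
Proof. by move=> pp <-; apply/connectP; exists p. Qed.

(** A path between two neighbors of [q] that avoids [q] would close up to a cycle. *)
Lemma neighbors_disconnected q x u : t q x -> t q u -> branch q x u -> x = u.
Proof.
move=> tqx tqu /branch_path[p [pp up lp]]; case: tree_t => _ _ _ acyc.
have xq : x != q by apply: contraTneq tqx => ->; rewrite tree_irr.
move: pp; rewrite path_avoiding // => /andP[pt qp].
case: p lp pt qp up => [//|y p] lp pt qp up; case: (acyc [:: q, x, y & p]) => //.
apply/andP; split; last by rewrite cons_uniq up inE eq_sym (negPf xq) qp.
change (path t q (rcons (x :: y :: p) q)).
rewrite rcons_path [last _ _]lp tree_sym tqu andbT.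
by rewrite [path _ _ _]/= tqx.
Qed.

Lemma branch_step q x u v : x != q -> branch q x u -> t u v -> v != q -> branch q x v.
Proof.
move=> xq xu tuv vq; apply: connect_trans (xu) (connect1 _).
rewrite /avoiding tuv vq andbT /=.
have [p [pp _ <-]] := branch_path xu; move: pp; rewrite path_avoiding // => /andP[_ qp].
by apply: contraTneq (mem_last x p) => ->; rewrite inE eq_sym (negPf xq).
Qed.

Lemma branch_exit q x u : t q x -> branch q x u -> t u q -> u = x.
Proof.
move=> tqx xu tuq; apply/esym/(neighbors_disconnected tqx) => //.
by rewrite tree_sym.
Qed.

Lemma root_notin_branch q x : t q x -> ~~ branch q x q.
Proof.
move=> tqx; have xq : x != q by apply: contraTneq tqx => ->; rewrite tree_irr.
apply/negP => /branch_path[p []]; rewrite path_avoiding // => /andP[_ qp] _ lp.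
by have := mem_last x p; rewrite lp inE eq_sym (negPf xq) (negPf qp).
Qed.

Lemma branch_refl q x : branch q x x. Proof. exact: connect0. Qed.

Lemma sub_branch q x y w : t q x -> t x y -> y != q -> branch x y w -> branch q x w.
Proof.
move=> tqx txy yq yw; have [p [pp up <-]] := branch_path yw.
have xq : x != q by apply: contraTneq tqx => ->; rewrite tree_irr.
have yx : y != x by apply: contraTneq txy => ->; rewrite tree_irr.
have qp : q \notin p.
  apply: contra yq => qp; apply/eqP/(neighbors_disconnected txy).
    by rewrite tree_sym.
  case/splitPr: qp pp => p1 p2; rewrite -cat_rcons cat_path => /andP[pp _].
  by apply: path_branch pp (last_rcons _ _ _).
apply: (@path_branch _ _ (y :: p)) => //.
rewrite path_avoiding // inE eq_sym (negPf yq) qp andbT /= txy.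
by move: pp; rewrite path_avoiding // => /andP[].
Qed.

Lemma branch_cases q x w : t q x -> branch q x w ->
  w = x \/ exists y, [/\ t x y, y != q & branch x y w].
Proof.
move=> tqx /branch_path[[|y p] [pp up lp]]; first by left.
have xq : x != q by apply: contraTneq tqx => ->; rewrite tree_irr.
right; exists y; move: pp; rewrite path_avoiding // inE negb_or.
move=> /andP[/= /andP[txy ytp] /andP[qy qp]].
split=> //; first by rewrite eq_sym.
have yx : y != x by apply: contraTneq txy => ->; rewrite tree_irr.
apply: (@path_branch x y p w _ lp); rewrite path_avoiding // ytp.
by move: up; rewrite /= inE negb_or => /andP[/andP[]].
Qed.

Lemma branches_disjoint x y z w : t x y -> t x z -> branch x y w -> branch x z w -> y = z.
Proof.
move=> txy txz yw zw; apply: (neighbors_disconnected txy txz); apply: connect_trans yw _.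
rewrite (_ : connect _ w z = branch x z w) //; apply: sym_connect_sym => u v.
by rewrite /avoiding tree_sym [(u != x) && _]andbC.
Qed.

Lemma branch_compl q x w : t q x -> branch x q w = ~~ branch q x w.
Proof.
move=> tqx; have xq : x != q by apply: contraTneq tqx => ->; rewrite tree_irr.
apply/idP/idP => [/branch_path[p [pp _ <-]]|].
  (* A walk that avoids [x] cannot enter [branch q x]: the only way in is [qx]. *)
  have stay u : ~~ branch q x u -> path (avoiding x) u p -> ~~ branch q x (last u p).
    elim: p u {pp} => //= v p IHp u nBu /andP[/and3P[tuv ux vx] pp].
    apply: IHp pp; apply: contra nBu => Bv; have [uq|uq] := eqVneq u q.
      by case/eqP: vx; apply: branch_exit Bv _ => //; rewrite tree_sym -uq.
    by apply: branch_step Bv _ uq; rewrite // tree_sym.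
  by apply: stay pp; exact: root_notin_branch.
case: tree_t => _ _ /(_ x w)/connectP[p pt ->] _ {w}; case/shortenP: pt => p' pt up _ nB.
have qp : q \in p'.
  apply: contraR nB => qp; apply: (@path_branch _ _ p') => //.
  by rewrite path_avoiding // pt.
case/splitPr: qp pt up nB => p1 p2 pt up _; rewrite last_cat /=.
apply: (@path_branch _ _ p2) => //.
rewrite path_avoiding 1?eq_sym //; move: pt; rewrite cat_path /= => /and3P[_ _ ->] /=.
move: up; rewrite -cat_cons cat_uniq => /and3P[_ /hasPn/= d _].
by apply/negP => xp2; have := d x; rewrite inE xp2 orbT mem_head => /(_ isT).
Qed.

Lemma sub_branch_card q x y :
  t q x -> t x y -> y != q -> (#|branch x y| < #|branch q x|)%N.
Proof.
move=> tqx txy yq; apply/proper_card/properP; split.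
  by apply/fintype.subsetP => w; apply: sub_branch.
by exists x; [exact: branch_refl|exact: root_notin_branch].
Qed.
End Branches.

(** * Consecutive entries of a list *)

Section ConvexSubsequences.
Variable T : eqType.
Implicit Types (P : pred T) (s : seq T).

Definition convex P s := forall s1 a s2 b s3 c s4,
  s = s1 ++ a :: s2 ++ b :: s3 ++ c :: s4 -> P a -> P c -> P b.

Lemma convex_interval P s : convex P s ->
  exists a m b, [/\ s = a ++ m ++ b, all P m, ~~ has P a & ~~ has P b].
Proof.
elim: s => [|x s IHs] cvx; first by exists [::], [::], [::].
have cvx_s : convex P s.
  by move=> s1 a s2 b s3 c s4 sE; apply: (cvx (x :: s1) a s2 b s3 c s4); rewrite sE.
have [[|y a] [m [b [sE Pm nPa nPb]]]] := IHs cvx_s.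
  have [Px|nPx] := boolP (P x).
    by exists [::], (x :: m), b; rewrite sE /= Px.
  by exists [:: x], m, b; rewrite sE /= orbF.
have [Px|nPx] := boolP (P x); last first.
  by exists (x :: y :: a), m, b; split; rewrite //= ?sE // negb_or nPx.
exists [::], [:: x], s; split=> //=; first by rewrite Px.
apply/hasPn => z; rewrite sE /= inE mem_cat mem_cat => zs; apply/negP => Pz.
have nPy : ~~ P y by move: nPa; rewrite /= negb_or => /andP[].
have : z \in m.
  case/or4P: zs => [/eqP zy|za|//|zb].
  - by rewrite -zy Pz in nPy.
  - by move: nPa; rewrite /= negb_or => /andP[_ /hasPn/(_ z za)]; rewrite Pz.
  - by move/hasPn: nPb => /(_ z zb); rewrite Pz.
move=> zm; case/splitPr: zm sE => m1 m2 sE; case/negP: nPy.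
by apply: (cvx [::] x [::] y (a ++ m1) z (m2 ++ b)) => //; rewrite sE /= -!catA.
Qed.

(** No entry of the interval of [P1] lies between two entries of [P2], so all of the
latter are on one side of it. *)
Lemma convex_filterU P1 P2 s :
  convex P1 s -> convex P2 s -> (forall v, P1 v -> ~~ P2 v) ->
  [seq v <- s | P1 v || P2 v] = [seq v <- s | P1 v] ++ [seq v <- s | P2 v] \/
  [seq v <- s | P1 v || P2 v] = [seq v <- s | P2 v] ++ [seq v <- s | P1 v].
Proof.
move=> cvx1 cvx2 dis; have [a [m [b [sE P1m nP1a nP1b]]]] := convex_interval cvx1.
have only2 c : ~~ has P1 c -> [seq v <- c | P1 v || P2 v] = [seq v <- c | P2 v].
  by move=> /hasPn nP1; apply: eq_in_filter => v /nP1/negPf ->.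
have none c : ~~ has P1 c -> [seq v <- c | P1 v] = [::].
  by move=> /hasPn nP1; apply/eqP; rewrite -(negbK (_ == _)) -has_filter; apply/hasPn.
have m_all : [seq v <- m | P1 v] = m by apply/all_filterP.
have m_union : [seq v <- m | P1 v || P2 v] = m.
  by apply/all_filterP; apply: sub_all P1m => v ->.
have m_none : [seq v <- m | P2 v] = [::].
  apply/eqP; rewrite -(negbK (_ == _)) -has_filter; apply/hasPn => v vm.
  by apply: dis; exact: (allP P1m).
rewrite sE !filter_cat (only2 a) // (only2 b) // (none a) // (none b) //.
rewrite m_all m_union m_none cats0 /=.
have [/hasP[u ua P2u]|] := boolP (has P2 a); last first.
  by rewrite has_filter negbK => /eqP ->; left.
have [/hasP[w wb P2w]|] := boolP (has P2 b); last first.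
  by rewrite has_filter negbK => /eqP ->; right; rewrite !cats0.
case: m => [|y m'] in sE P1m m_all m_union m_none *; first by left.
have /negP[] : ~~ P2 y by apply: dis; case/andP: P1m.
case/splitPr: ua sE => a1 a2; case/splitPr: wb => b1 b2 sE.
by apply: (cvx2 a1 u a2 y (m' ++ b1) w b2) => //; rewrite sE -?catA /= -?catA.
Qed.

Lemma convex_consecutive P s : convex P s ->
  exists a b, s = a ++ [seq v <- s | P v] ++ b.
Proof.
case/convex_interval=> a [m [b [-> Pm /hasPn nPa /hasPn nPb]]]; exists a, b.
rewrite !filter_cat (all_filterP Pm).
rewrite (@eq_in_filter _ P pred0 a) => [|v /nPa/negPf //].
by rewrite (@eq_in_filter _ P pred0 b) => [|v /nPb/negPf //]; rewrite !filter_pred0 cats0.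
Qed.

(** The list is read cyclically: after its last entry comes its head [x]. *)
Lemma next_in_list x s u w v : uniq s -> s = x :: behead s -> s = u ++ w :: v ->
  next s w = head x v.
Proof.
move=> us sx sE; rewrite -(next_rot (size u) us) {1}sE rot_size_cat.
case: v => [|z v] in sE *; last by rewrite /= eqxx.
by case: u sE => [|z u] sE; rewrite sE /= in sx *; case: sx => ->; rewrite /= ?eqxx.
Qed.

(** Two adjacent blocks [m1] and [m2] of a cyclic list touch only at the seam between
them, provided that the list does not begin with [m1]. *)
Section Blocks.
Variables (x : T) (s a m1 m2 b : seq T).
Hypothesis uniq_s : uniq s.
Hypothesis s_head : s = x :: behead s.
Hypothesis sE : s = a ++ m1 ++ m2 ++ b.

Lemma outside_block v : v \in a ++ m2 ++ b -> v \notin m1.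
Proof.
by move: uniq_s; rewrite sE uniq_catCA cat_uniq => /and3P[_ /hasPn dis _] /dis.
Qed.

Lemma next_across u w v : v \in m1 -> next s v \in m2 ->
  v = last u m1 /\ next s v = head w m2.
Proof.
move=> vm nm; have : next s v \notin m1 by apply: outside_block; rewrite !mem_cat nm orbT.
case/splitPr: vm sE => c d sE'; have -> : next s v = head x (d ++ m2 ++ b).
  by apply: (next_in_list (u := a ++ c)) => //; rewrite sE' -!catA.
case: d sE' => [|z d] sE' /=; first by rewrite last_cat; case: (m2) nm.
by rewrite !(mem_cat, inE) eqxx !orbT.
Qed.

Lemma next_not_back w : a != [::] -> w \in m2 -> next s w \notin m1.
Proof.
move=> a0 wm; apply: outside_block.
case/splitPr: wm (sE) => c d sE'; have -> : next s w = head x (d ++ b).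
  by apply: (next_in_list (u := a ++ m1 ++ c)) => //; rewrite sE' -!catA.
case: d sE' => [|z d] sE' /=; last by rewrite !(mem_cat, inE) eqxx !orbT.
case: (b) => [|z b'] /=; last by rewrite !(mem_cat, inE) eqxx !orbT.
by case: (a) a0 sE' => // z a' _; rewrite s_head => -[-> _]; rewrite mem_head.
Qed.

Lemma next_seam u w : m1 != [::] -> m2 != [::] -> next s (last u m1) = head w m2.
Proof.
case/lastP: m1 sE => // c v sE' _; rewrite last_rcons => m20.
have -> : next s v = head x (m2 ++ b).
  by apply: (next_in_list (u := a ++ c)) => //; rewrite sE' cat_rcons catA.
by case: (m2) m20.
Qed.
End Blocks.
End ConvexSubsequences.

(** * Colorings seen from outside *)

(** The condition on a vertex of color [c] with neighbors of colors [ns]: at every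
vertex it says that the coloring is a packing coloring, color 0 being the class
of the 1 and the others the classes of the 2s. *)
Definition star (c : nat) (ns : seq nat) : bool :=
  uniq [seq k <- c :: ns | k != 0] && ((c == 0) ==> (0 \notin ns)).

(** The arguments are the colors on the three edges leaving a branch: root and its
outer neighbor, first leaf and its outer neighbor, last leaf and its outer
neighbor.  The set is closed under the splitting in [joinable] and small enough
for the closure to be checked by computation; its second part provides the
coloring around the root of the whole tree. *)
Definition flexible (x q l l' r r' : nat) : bool :=
  [|| uniq [:: x; q; l; l'; r; r'],
      [&& q == 0, l' == 0, r' == 0 & uniq [:: 0; x; l; r]]
    | [&& l' == r', l' != 0, 0 \in [:: x; q] & uniq [:: x; q; l; r; l']]].

Definition single (x q l l' r r' : nat) : bool :=
  [&& l == x, r == x & star x [:: q; l'; r']].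

Definition realizable (is_leaf : bool) := if is_leaf then single else flexible.

Definition colors := iota 0 6.

(** A branch with root [x] consists of [x] and two branches with roots colored [y]
and [z]; the last leaf of the one and the first leaf of the other are adjacent
on the cycle, and [i] and [o] are the colors of these two leaves. *)
Definition joinable (leaf1 leaf2 : bool) (x q l l' r r' : nat) : bool :=
  has (fun y => has (fun z => star x [:: q; y; z] &&
    has (fun i => has (fun o =>
      realizable leaf1 y x l l' i o && realizable leaf2 z x o i r r')
    colors) colors) colors) colors.

Lemma flexible_joinable leaf1 leaf2 x q l l' r r' :
  all (mem colors) [:: x; q; l; l'; r; r'] -> flexible x q l l' r r' ->
  joinable leaf1 leaf2 x q l l' r r'.
Proof.
suff checked : all (fun x => all (fun q => all (fun l => all (fun l' =>
    all (fun r => all (fun r' =>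
      flexible x q l l' r r' ==> joinable leaf1 leaf2 x q l l' r r')
    colors) colors) colors) colors) colors) colors.
  move=> /= /and5P[xC qC lC l'C /and3P[rC r'C _]]; apply/implyP.
  move: checked => /allP/(_ x xC)/allP/(_ q qC)/allP/(_ l lC)/allP/(_ l' l'C).
  by move=> /allP/(_ r rC)/allP/(_ r' r'C).
(* [lazy] stops each search at its first success, unlike call-by-value. *)
by case: leaf1; case: leaf2; lazy.
Qed.

Lemma star_perm c ns ns' : perm_eq ns ns' -> star c ns = star c ns'.
Proof.
move=> nsE; rewrite /star; congr (_ && _); last by rewrite (perm_mem nsE).
by apply: perm_uniq; apply: perm_filter; rewrite perm_cons.
Qed.

(** * A tree with a cycle through its leaves *)

Section SkirtedTree.
Variables (V : finType) (t e : rel V) (s : seq V).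
Hypothesis tree_t : tree t.
Hypothesis uniq_s : uniq s.
Hypothesis s_leaves : forall x, (x \in s) = leaf t x.
Hypothesis eE : forall x y, e x y = t x y || cycle_edge s x y.
Implicit Types q x y z u v w : V.

Let tsym : symmetric t. Proof. exact: tree_sym. Qed.
Let tirr : irreflexive t. Proof. exact: tree_irr. Qed.

Let e_sym : symmetric e.
Proof.
by move=> x y; rewrite !eE tsym /cycle_edge orbC [in LHS]andbCA [(y == _) || _]orbC orbC.
Qed.

Lemma leaf_neighbor x u v : leaf t x -> t x u -> t x v -> u = v.
Proof.
move=> /card1P[w wP] txu txv.
have := wP u; have := wP v.
by rewrite !inE /in_mem /= txu txv => /esym/eqP -> /esym/eqP ->.
Qed.

(** A path in a tree passes through leaves only at its ends. *)
Lemma tree_link q x a : t q x -> ~~ leaf t x -> branch t q x a ->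
  linked e [pred v | branch t q x v && (leaf t v ==> (v == a))] x a.
Proof.
move=> tqx nlx xa; have [p [pp up lp]] := branch_path xa.
have inB v : v \in x :: p -> branch t q x v.
  rewrite inE => /orP[/eqP->|vp]; first exact: branch_refl.
  case/splitPr: vp pp {up lp} => p1 p2; rewrite -cat_rcons cat_path => /andP[pp _].
  by apply: path_branch pp _; rewrite last_rcons.
exists p; split=> //.
  by apply: sub_path pp => u v; rewrite eE /avoiding => /and3P[->].
apply/allP => v vp; rewrite inE inB //=; apply/implyP => lv.
move: vp; rewrite inE => /orP[/eqP vx|vp]; first by rewrite vx (negPf nlx) in lv.
case/splitPr: vp pp up lp => p1 [|w p2] pp up lp; first by rewrite -lp last_cat.
move: pp; rewrite cat_path /= => /and3P[_ /and3P[tuv _ _] /andP[/and3P[tvw _ _] _]].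
rewrite tsym in tuv; have uw := leaf_neighbor lv tuv tvw.
move: up; rewrite -cat_cons cat_uniq => /and3P[_ /hasPn/(_ w) + _].
have wp : w \in x :: p1 by rewrite -uw mem_last.
by rewrite in_cons mem_head orbT => /(_ isT); rewrite /= wp.
Qed.

Lemma leaf_cycle_path x s' : s = x :: s' -> path e x (rcons s' x).
Proof.
move=> sE; have := cycle_next uniq_s; rewrite {2}sE /=.
apply: (sub_in_path (P := mem s)) => [u v us vs /eqP uv|].
  by rewrite eE /cycle_edge us vs uv eqxx orbT.
by apply/allP => y; rewrite sE !inE mem_rcons inE orbA orbb.
Qed.

Lemma leaf_branch q x : t q x -> leaf t x -> branch t q x =1 pred1 x.
Proof.
move=> tqx lx v; apply/idP/eqP => [|->]; last exact: branch_refl.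
case/(branch_cases tree_t tqx) => // -[y [txy yq _]].
by case/eqP: yq; apply: leaf_neighbor lx txy _; rewrite tsym.
Qed.

(** The vertices [x], [b1], [b2] and [q], [a1], [a2] are those of a K_{3,3}: the tree
joins [x] to [a1] and [a2], [q] to [b1] and [b2], and [x] to [q], and the cycle
joins each [b] to each [a]. *)
Lemma no_crossing alpha T q x a1 a2 b1 b2 s1 s2 s3 s4 :
  turning_system e alpha T -> t q x ->
  s = b2 :: s1 ++ a1 :: s2 ++ b1 :: s3 ++ a2 :: s4 ->
  branch t q x a1 -> branch t q x a2 ->
  ~~ branch t q x b1 -> ~~ branch t q x b2 -> False.
Proof.
move=> ts tqx sE xa1 xa2 xb1 xb2.
have txq : t x q by rewrite tsym.
rewrite -!branch_compl // in xb1 xb2.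
have := leaf_cycle_path sE; rewrite -!cat_rcons !rcons_cat.
rewrite !cat_path !last_rcons => /and4P[arc1 arc2 arc3 arc4].
(* Counting the occurrences of [v] in [s] turns all the disjointness facts below
   into linear arithmetic. *)
have once v : (b2 == v) + (count_mem v s1 + ((a1 == v) + (count_mem v s2 +
    ((b1 == v) + (count_mem v s3 + ((a2 == v) + count_mem v s4)))))) <= 1.
  have := count_uniq_mem v uniq_s; rewrite sE /=.
  do 3 rewrite count_cat /=.
  move=> ->.
  exact: leq_b1.
have mem_arc (v y : V) p z :
    (v \in y :: rcons p z) = (0 < (y == v) + (count_mem v p + (z == v))).
  by rewrite -has_pred1 has_count -cats1 /= count_cat /= addn0.
have nlx : ~~ leaf t x.
  apply/negP => lx; rewrite !(leaf_branch tqx lx) /= in xa1 xa2.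
  by have := once x; rewrite (eqP xa1) (eqP xa2) eqxx; clear; lia.
have nlq : ~~ leaf t q.
  apply/negP => lq; rewrite !(leaf_branch txq lq) /= in xb1 xb2.
  by have := once q; rewrite (eqP xb1) (eqP xb2) eqxx; clear; lia.
pose X (i : 'I_3) := nth x [:: x; b1; b2] i; pose Y (i : 'I_3) := nth q [:: q; a1; a2] i.
pose side u v a : pred V := [pred w | branch t u v w && (leaf t w ==> (w == a))].
pose S (i j : 'I_3) : pred V := fun v => nth false (nth [::]
  [:: [:: v \in [:: x; q]; side q x a1 v; side q x a2 v];
      [:: side x q b1 v; v \in a1 :: rcons s2 b1; v \in b1 :: rcons s3 a2];
      [:: side x q b2 v; v \in b2 :: rcons s1 a1; v \in a2 :: rcons s4 b2]] i) j.
apply: (@no_K33 V e alpha T ts S X Y) => [i j|].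
  have arc y p z : path e y (rcons p z) -> linked e [in y :: rcons p z] y z.
    by move=> yp; exists (rcons p z); split; rewrite ?last_rcons //; apply/allP.
  case: i => [[|[|[|i]]] iP] //; case: j => [[|[|[|j]]] jP] //; rewrite /X /Y /S /=.
  - by exists [:: q]; split; rewrite //= ?eE ?txq // !inE !eqxx ?orbT.
  - exact: tree_link.
  - exact: tree_link.
  - by apply: (linked_sym e_sym); apply: tree_link.
  - by apply: (linked_sym e_sym); apply: arc.
  - by apply: arc.
  - by apply: (linked_sym e_sym); apply: tree_link.
  - by apply: arc.
  - by apply: (linked_sym e_sym); apply: arc.
have arc_leaf v : (v \in a1 :: rcons s2 b1) || (v \in b1 :: rcons s3 a2)
    || (v \in b2 :: rcons s1 a1) || (v \in a2 :: rcons s4 b2) -> leaf t v.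
  rewrite -s_leaves sE !(inE, mem_cat, mem_rcons).
  by case: (v == a1); case: (v == a2); case: (v == b1); case: (v == b2);
     rewrite ?orbT //=; case: (v \in s1); case: (v \in s2); case: (v \in s3); case: (v \in s4).
have side_arc u w a v : side u w a v -> leaf t v -> v = a.
  by rewrite /side inE => /andP[_ /implyP lv] /lv/eqP.
have side_side a b v : side q x a v -> side x q b v -> False.
  by rewrite /side !inE (branch_compl tree_t _ tqx) => /andP[xv _] /andP[]; rewrite xv.
have xq_arc v : v \in [:: x; q] -> leaf t v -> False.
  by rewrite !inE => /orP[] /eqP ->; apply/negP.
move=> i i' j j' ii jj v; move: ii jj.
case: i => [[|[|[|i]]] iP] //; case: i' => [[|[|[|i']]] iP'] //;
  case: j => [[|[|[|j]]] jP] //; case: j' => [[|[|[|j']]] jP'] // _ _;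
  rewrite /S /=.
all: move=> h1 h2.
all: try by [case: (side_side _ _ _ h1 h2)|case: (side_side _ _ _ h2 h1)].
all: try by [case: (xq_arc v h1); apply: arc_leaf; rewrite h2 ?orbT
            |case: (xq_arc v h2); apply: arc_leaf; rewrite h1 ?orbT].
(* At least one of the two sets is now a part of the cycle, so [v] is a leaf, and
   if the other one is a path in the tree, then [v] is its end. *)
all: have := once v.
all: have lv : leaf t v by apply: arc_leaf; rewrite ?h1 ?h2 ?orbT.
all: try have va := side_arc _ _ _ _ h1 lv; try have va := side_arc _ _ _ _ h2 lv.
all: try move: h1; try move: h2; try rewrite va.
all: by rewrite ?mem_arc ?eqxx; clear; lia.
Qed.

(** * Coloring branches *)

Variable p0 : V.
Hypothesis e_irr : irreflexive e.
Hypothesis e_cubic : cubic e.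
Hypothesis s_head : s = p0 :: behead s.
Hypothesis branch_convex :
  forall q x, t q x -> ~~ branch t q x p0 -> convex (branch t q x) s.

Lemma leaf_neighborhood v u : leaf t v -> t v u ->
  uniq [:: u; prev s v; next s v] /\ e v =i [:: u; prev s v; next s v].
Proof.
move=> lv tvu; have vs : v \in s by rewrite s_leaves.
have evE : e v =i [:: u; prev s v; next s v].
  move=> w; rewrite !inE (_ : (w \in e v) = e v w) // eE; congr (_ || _).
    by apply/idP/eqP => [tvw|-> //]; exact: (leaf_neighbor lv tvw tvu).
  rewrite /cycle_edge vs /=; have [->|wv] := eqVneq w (next s v).
    by rewrite mem_next vs orbT.
  rewrite orbF /=; apply/andP/eqP => [[ws /eqP ->]|->].
    by rewrite (prev_next uniq_s).
  by rewrite mem_prev (next_prev uniq_s).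
split=> //; apply/card_uniqP; rewrite -(eq_card evE); exact: e_cubic.
Qed.

Lemma node_neighborhood x q : ~~ leaf t x -> t x q -> exists y z,
  uniq [:: q; y; z] /\ e x =i [:: q; y; z] /\ t x =i [:: q; y; z].
Proof.
move=> nlx txq; have exE : e x =i t x.
  move=> w; rewrite (_ : (w \in e x) = e x w) //.
  by rewrite eE /cycle_edge s_leaves (negPf nlx) orbF.
have : perm_eq (enum (e x)) (q :: rem q (enum (e x))).
  by apply: perm_to_rem; rewrite mem_enum exE.
have : size (enum (e x)) = 3 by rewrite -cardE; exact: e_cubic.
move=> sz pe; have := perm_size pe; rewrite sz.
case: (rem _ _) pe => [|y [|z [|]]] //= pe _.
exists y, z; have exqyz : e x =i [:: q; y; z].
  by move=> w; rewrite -mem_enum (perm_mem pe).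
split; first by have := enum_uniq (e x); rewrite (perm_uniq pe).
by split=> // w; rewrite -exE.
Qed.

Definition branch_leaves q x := [seq v <- s | branch t q x v].
Definition first_leaf q x := head x (branch_leaves q x).
Definition last_leaf q x := last x (branch_leaves q x).

(** Here [f v] is the color of [v], and [g v w] is the color that [v] sees on its
neighbor [w].  The two agree inside the branch, but the colors seen outside are
prescribed separately for each of the three outgoing edges, since two of them
may have the same outer end. *)
Definition branch_coloring q x cq cl cl' cr cr'
    (f : V -> nat) (g : V -> V -> nat) :=
  [/\ forall v, branch t q x v ->
        star (f v) (map (g v) (enum (e v))) && (f v \in colors),
      forall v w, branch t q x v -> branch t q x w -> e v w -> g v w = f w,
      g x q = cq,
      f (first_leaf q x) = cl /\
        g (first_leaf q x) (prev s (first_leaf q x)) = cl'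
    & f (last_leaf q x) = cr /\
        g (last_leaf q x) (next s (last_leaf q x)) = cr'].

Definition branch_colorable q x := forall cx cq cl cl' cr cr',
  all (mem colors) [:: cx; cq; cl; cl'; cr; cr'] ->
  realizable (leaf t x) cx cq cl cl' cr cr' ->
  exists f g, f x = cx /\ branch_coloring q x cq cl cl' cr cr' f g.

Lemma leaf_colorable q x : t q x -> leaf t x -> branch_colorable q x.
Proof.
move=> tqx lx cx cq cl cl' cr cr' inC.
rewrite /realizable lx => /and3P[/eqP clx /eqP crx st].
have [u3 exE] := leaf_neighborhood lx (etrans (tsym _ _) tqx).
pose g (v w : V) := if w == q then cq else if w == prev s x then cl' else cr'.
have gq : g x q = cq by rewrite /g eqxx.
move: (u3); rewrite /= !inE negb_or andbT => /andP[/andP[qp qn] pn].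
have gp : g x (prev s x) = cl' by rewrite /g eqxx eq_sym (negPf qp).
have gn : g x (next s x) = cr' by rewrite /g [_ == q]eq_sym (negPf qn) eq_sym (negPf pn).
have BE := leaf_branch tqx lx.
have mE : branch_leaves q x = [:: x].
  by rewrite /branch_leaves (eq_filter BE) filter_pred1_uniq // s_leaves.
exists (fun=> cx), g; split=> //.
rewrite /branch_coloring /first_leaf /last_leaf mE /=; split=> //.
- move=> v; rewrite BE => /eqP ->; apply/andP; split; last by case/andP: inC.
  rewrite (@star_perm _ _ [:: cq; cl'; cr']) //.
  rewrite -gq -gp -gn -[[:: _; _; _]]/(map (g x) [:: q; _; _]).
  by apply: perm_map; apply: uniq_perm; rewrite ?enum_uniq // => w; rewrite mem_enum.
- by move=> v w; rewrite !BE => /eqP -> /eqP ->; rewrite e_irr.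
Qed.
(** The colors of the branches at [y] and [z] are chosen by [flexible_joinable].
The only edges between the three parts are [xy], [xz] and the edge of the cycle at
the seam of the two intervals of leaves. *)
Lemma join_colorable q x y z :
  t q x -> ~~ leaf t x -> ~~ branch t q x p0 ->
  uniq [:: q; y; z] -> t x =i [:: q; y; z] ->
  branch_colorable x y -> branch_colorable x z ->
  branch_leaves x y != [::] -> branch_leaves x z != [::] ->
  branch_leaves q x = branch_leaves x y ++ branch_leaves x z ->
  branch_colorable q x.
Proof.
move=> tqx nlx p0B uqyz txE coly colz my0 mz0 mE cx cq cl cl' cr cr' inC.
rewrite /realizable (negPf nlx) => flex.
move: (flexible_joinable (leaf t y) (leaf t z) inC flex).
case/hasP=> cy cyC /hasP[cz czC /andP[stx]].
case/hasP=> ci ciC /hasP[co coC /andP[realy realz]].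
case/and5P: inC => cxC cqC clC cl'C /and3P[crC cr'C _].
have inY : all (mem colors) [:: cy; cx; cl; cl'; ci; co] by do !(apply/andP; split=> //).
have inZ : all (mem colors) [:: cz; cx; co; ci; cr; cr'] by do !(apply/andP; split=> //).
have [fy [gy [fyy [sty inny gyx [fl gl] [fi gi]]]]] :=
  coly _ _ _ _ _ _ inY realy.
have [fz [gz [fzz [stz innz gzx [fo go] [fr gr]]]]] :=
  colz _ _ _ _ _ _ inZ realz.
have txy : t x y by have : y \in t x by rewrite txE !inE eqxx orbT.
have txz : t x z by have : z \in t x by rewrite txE !inE eqxx !orbT.
move: (uqyz); rewrite /= !inE negb_or andbT => /andP[/andP[qy qz] yz].
pose By := branch t x y; pose Bz := branch t x z.
have dis v : By v -> Bz v -> False.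
  by move=> yv zv; case/eqP: yz; exact: (branches_disjoint tree_t txy txz yv zv).
have xBy : By x = false by apply/negbTE/(root_notin_branch tree_t).
have xBz : Bz x = false by apply/negbTE/(root_notin_branch tree_t).
have subBy v : By v -> branch t q x v by apply: (sub_branch tree_t) => //; rewrite eq_sym.
have subBz v : Bz v -> branch t q x v by apply: (sub_branch tree_t) => //; rewrite eq_sym.
have BE v : branch t q x v -> [\/ v = x, By v | Bz v].
  case/(branch_cases tree_t tqx) => [->|[w [txw wq xw]]]; first by constructor 1.
  have : w \in t x by [].
  rewrite txE !inE (negPf wq) /= => /orP[] /eqP wE; rewrite wE in xw.
    by constructor 2.
  by constructor 3.
have exE v : e x v = (v \in [:: q; y; z]).
  by rewrite -txE eE /cycle_edge s_leaves (negPf nlx) orbF.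
have eq_child u v : t x u -> branch t x u v -> e x v -> v = u.
  move=> txu uv; rewrite exE -txE => txv; apply/esym.
  exact: (neighbors_disconnected tree_t txu txv uv).
move: my0 mz0 mE fl gl fi gi fo go fr gr.
rewrite /first_leaf /last_leaf.
set my := branch_leaves x y; set mz := branch_leaves x z.
move=> my0 mz0 mE fl gl fi gi fo go fr gr.
have in_my v : v \in my -> By v by rewrite mem_filter => /andP[].
have in_mz v : v \in mz -> Bz v by rewrite mem_filter => /andP[].
have headE (m : seq V) u v : m != [::] -> head u m = head v m by case: m.
have lastE (m : seq V) u v : m != [::] -> last u m = last v m by case: m.
have head_in (m : seq V) u : m != [::] -> head u m \in m.
  by case: m => //= w m _; exact: mem_head.
have last_in (m : seq V) u : m != [::] -> last u m \in m.
  by case: m => //= w m _; exact: mem_last.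
have lE : head x (my ++ mz) = head y my.
  by rewrite -(headE my x) //; case: (my) my0.
have rE : last x (my ++ mz) = last z mz by rewrite last_cat (lastE mz _ z).
have Byl := in_my _ (head_in _ y my0); have Byr := in_my _ (last_in _ y my0).
have Bzl := in_mz _ (head_in _ z mz0); have Bzr := in_mz _ (last_in _ z mz0).
have notBy v : Bz v -> By v = false.
  by move=> zv; apply/negP => yv; exact: dis yv zv.
have [a [b sE]] : exists a b, s = a ++ my ++ mz ++ b.
  have [a [b]] := convex_consecutive (branch_convex tqx p0B).
  by rewrite -/(branch_leaves q x) mE -catA; exists a, b.
have a0 : a != [::].
  case: (a) sE => // sE; have : p0 \in my ++ mz.
    by case: (my) my0 sE => // u m _; rewrite s_head => -[-> _]; exact: mem_head.
  by rewrite -mE mem_filter (negPf p0B).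
have leaf_edge v w : By v -> Bz w -> e v w -> cycle_edge s v w.
  move=> Bv Bw; rewrite eE => /orP[tvw|//]; case: (dis w) => //.
  apply: (branch_step _ Bv tvw); first by apply: contraTneq txy => ->; rewrite tirr.
  by apply: contraTneq Bw => ->; rewrite xBz.
have seam v w : By v -> Bz w -> e v w -> v = last y my /\ w = head z mz.
  move=> Bv Bw /(leaf_edge v w Bv Bw)/and3P[vs ws vw].
  have vm : v \in my by rewrite mem_filter; apply/andP.
  have wm : w \in mz by rewrite mem_filter; apply/andP.
  case/orP: vw => /eqP vw; last first.
    by move: vm; rewrite vw (negPf (next_not_back uniq_s s_head sE a0 wm)).
  by have := next_across uniq_s s_head sE y z vm; rewrite -vw => /(_ wm).
have seam_next : next s (last y my) = head z mz.
  exact: (next_seam uniq_s s_head sE).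
exists (fun v => if By v then fy v else if Bz v then fz v else cx).
exists (fun v w => if By v then gy v w else if Bz v then gz v w else
                   if w == y then cy else if w == z then cz else cq).
rewrite xBy xBz; split=> //; rewrite /branch_coloring /first_leaf /last_leaf.
rewrite mE lE rE Byl xBy xBz (notBy _ Bzr) Bzr.
split=> //.
- move=> v /BE[->|Bv|Bv].
  + rewrite xBy xBz; apply/andP; split; last exact: cxC.
    rewrite (@star_perm _ _ [:: cq; cy; cz]) //.
    have -> : [:: cq; cy; cz] =
        map (fun w => if w == y then cy else if w == z then cz else cq) [:: q; y; z].
      by rewrite /= !eqxx (negPf qy) (negPf qz) [z == y]eq_sym (negPf yz).
    apply: perm_map; apply: uniq_perm; rewrite ?enum_uniq // => w.
    by rewrite mem_enum -exE.
  + by rewrite Bv; exact: sty.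
  + by rewrite notBy // Bv; exact: stz.
- move=> v w /BE[->|Bv|Bv] /BE[->|Bw|Bw].
  + by rewrite e_irr.
  + by move=> exw; rewrite xBy xBz Bw (eq_child y w txy Bw exw) eqxx fyy.
  + move=> exw; rewrite xBy xBz (notBy _ Bw) Bw (eq_child z w txz Bw exw) eqxx fzz.
    by rewrite eq_sym (negPf yz).
  + by rewrite e_sym => exv; rewrite xBy xBz Bv (eq_child y v txy Bv exv) gyx.
  + by rewrite Bv Bw; exact: inny.
  + move=> evw; have [vE wE] := seam _ _ Bv Bw evw; rewrite Bv (notBy _ Bw) Bw.
    by rewrite vE wE fo -gi seam_next.
  + rewrite e_sym => exv; rewrite xBy xBz (notBy _ Bv) Bv.
    by rewrite (eq_child z v txz Bv exv) gzx.
  + rewrite e_sym => ewv; have [wE vE] := seam _ _ Bw Bv ewv; rewrite (notBy _ Bv) Bv Bw.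
    by rewrite wE vE fi -go -seam_next (prev_next uniq_s).
  + by rewrite (notBy _ Bv) (notBy _ Bw) Bv Bw; exact: innz.
- by rewrite (negPf qy) (negPf qz).
Qed.

Lemma branch_colored q x : t q x -> ~~ branch t q x p0 ->
  branch_leaves q x != [::] /\ branch_colorable q x.
Proof.
have [n] := ubnP #|branch t q x|; elim: n q x => // n IHn q x Bn tqx p0B.
have [lx|nlx] := boolP (leaf t x).
  split; last exact: leaf_colorable.
  by rewrite -has_filter; apply/hasP; exists x; rewrite ?s_leaves ?branch_refl.
have txq : t x q by rewrite tsym.
have [y [z [uqyz [_ txE]]]] := node_neighborhood nlx txq.
have child u : u \in [:: y; z] -> [/\ t x u, u != q,
    branch_leaves x u != [::] & branch_colorable x u].
  move=> uyz; have txu : t x u by have : u \in t x by rewrite txE inE uyz orbT.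
  have uq : u != q by move: uqyz => /= /andP[qyz _]; apply: contraNneq qyz => <-.
  have Bu := leq_trans (sub_branch_card tree_t tqx txu uq) Bn.
  have [|u0 colu] := IHn x u Bu txu; last by split.
  by apply: contra p0B; exact: (sub_branch tree_t).
have [txy yq y0 coly] := child y (mem_head _ _).
have [txz zq z0 colz] : [/\ t x z, z != q, branch_leaves x z != [::]
    & branch_colorable x z].
  by apply: child; rewrite !inE eqxx orbT.
have yz : y != z by move: uqyz; rewrite /= !inE => /and3P[_ ? _].
have cvx u : t x u -> u != q -> convex (branch t x u) s.
  move=> txu uq; apply: branch_convex => //; apply: contra p0B.
  exact: (sub_branch tree_t).
have dis v : branch t x y v -> ~~ branch t x z v.
  move=> yv; apply: contra yz => zv; apply/eqP.
  exact: (branches_disjoint tree_t txy txz yv zv).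
have leavesE : branch_leaves q x = [seq v <- s | branch t x y v || branch t x z v].
  apply: eq_in_filter => v vs; apply/idP/orP.
    case/(branch_cases tree_t tqx) => [vx|[u [txu uq xu]]].
      by move: nlx; rewrite -vx -s_leaves vs.
    have : u \in t x by [].
    rewrite txE !inE (negPf uq) /= => /orP[] /eqP uE; rewrite uE in xu.
      by left.
    by right.
  by case; exact: (sub_branch tree_t).
split.
  move: y0; rewrite leavesE -!has_filter; apply: sub_has => v /= xv.
  by apply/orP; left.
have [mE|mE] := convex_filterU (cvx y txy yq) (cvx z txz zq) dis;
  rewrite -leavesE in mE.
  exact: (join_colorable tqx nlx p0B uqyz txE coly colz y0 z0 mE).
apply: (join_colorable (y := z) (z := y)) mE => //.
  by move: uqyz; rewrite /= !inE [z == y]eq_sym [(q == z) || _]orbC.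
by move=> v; rewrite txE !inE [(v == y) || _]orbC.
Qed.

(** The branch consisting of everything but [p0] is colored with [p0] seen as 0 along
all three of its edges. *)
Lemma halin_star_coloring : exists f : V -> nat,
  forall v, star (f v) (map f (enum (e v))) && (f v \in colors).
Proof.
have p0s : p0 \in s by rewrite s_head mem_head.
have lp0 : leaf t p0 by rewrite -s_leaves.
have [x tp0x] : exists x, t p0 x.
  by case/card1P: (lp0) => x /(_ x); rewrite !inE eqxx => ?; exists x.
have tx0p : t x p0 by rewrite tsym.
have [u3 ep0] := leaf_neighborhood lp0 tp0x.
have BE v : branch t p0 x v = (v != p0).
  by rewrite -[LHS]negbK -(branch_compl tree_t v tp0x) (leaf_branch tx0p lp0).
have next_neq : next s p0 != p0.
  have : next s p0 \in e p0 by rewrite ep0 !inE eqxx !orbT.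
  by apply: contraTneq => ->; rewrite (_ : (p0 \in e p0) = e p0 p0) // e_irr.
have nlx : ~~ leaf t x.
  apply/negP => lx; have := leaf_branch tp0x lx (next s p0).
  rewrite BE next_neq => /esym/eqP nx.
  by move: u3; rewrite nx /= !inE eqxx orbT.
have [|s0 col] := branch_colored tp0x; first by rewrite BE eqxx.
have [||f [g [fx [stf inn gx [fl gl] [fr gr]]]]] := col 1 0 2 0 3 0; first by [].
  by rewrite /realizable (negPf nlx).
have leavesE : branch_leaves p0 x = behead s.
  rewrite /branch_leaves (eq_filter BE) s_head /= eqxx /=; apply/all_filterP/allP => v vs.
  move: uniq_s; rewrite s_head /=; case/andP=> p0s' _.
  by apply: contraNneq p0s' => <-.
have s1 : behead s != [::] by rewrite -leavesE.
have firstE : first_leaf p0 x = next s p0.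
  rewrite (next_in_list (u := [::]) uniq_s s_head s_head) /first_leaf leavesE.
  by case: (behead s) s1.
have lastE : last_leaf p0 x = prev s p0.
  rewrite /last_leaf leavesE; have : s = p0 :: behead s by [].
  case/lastP: (behead s) s1 => // s' v _ sE; rewrite last_rcons.
  have <- : next s v = p0.
    by rewrite (next_in_list (u := p0 :: s') (v := [::]) uniq_s s_head) // sE /= cats1.
  by rewrite prev_next.
rewrite firstE (prev_next uniq_s) in fl gl; rewrite lastE (next_prev uniq_s) in fr gr.
exists (fun v => if v == p0 then 0 else f v) => v.
have [->|vp0] := eqVneq v p0.
  rewrite andbT (@star_perm _ _ [:: 1; 3; 2]) //.
  have xp0 : x != p0 by apply: contraTneq tp0x => ->; rewrite tirr.
  have pp0 : prev s p0 != p0.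
    by apply: contra next_neq => /eqP pE; apply/eqP; rewrite -{1}pE next_prev.
  have -> : [:: 1; 3; 2] =
      map (fun v => if v == p0 then 0 else f v) [:: x; prev s p0; next s p0].
    by rewrite /= (negPf xp0) (negPf pp0) (negPf next_neq) fx fr fl.
  apply: perm_map; apply: uniq_perm; rewrite ?enum_uniq // => w.
  by rewrite mem_enum ep0.
rewrite -BE in vp0; suff -> : map (fun v => if v == p0 then 0 else f v) (enum (e v)) =
    map (g v) (enum (e v)).
  exact: stf.
apply/eq_in_map => w; rewrite mem_enum => vw.
have [wp0|wp0] := eqVneq w p0; last by rewrite inn // BE.
have : v \in e p0 by rewrite (_ : (v \in e p0) = e p0 v) // e_sym -wp0.
by rewrite ep0 wp0 !inE => /or3P[] /eqP ->.
Qed.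
End SkirtedTree.

(** * Packing colorings *)

Lemma star_edge c c' ns : star c ns -> c' \in ns -> c' != c.
Proof.
rewrite /star => /andP[nz z] c'ns; apply: contraTneq c'ns => ->.
have [c0|c0] := eqVneq c 0; first by move: z; rewrite c0.
by move: nz; rewrite /= c0 /= mem_filter c0 => /andP[].
Qed.

Lemma star_distinct (V : finType) (f : V -> nat) (N : seq V) c u v :
  uniq N -> star c (map f N) -> u \in N -> v \in N -> u != v -> f u != 0 ->
  f v != f u.
Proof.
move=> uN st uN' vN uv fu0; apply/negP => /eqP fvu.
have := star_perm c (perm_map f (perm_to_rem uN')); rewrite st => /esym/andP[+ _].
have : f u \in [seq k <- map f (rem u N) | k != 0].
  by rewrite mem_filter fu0 -fvu map_f // mem_rem_uniq // inE vN andbT eq_sym.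
by rewrite /= fu0 => fuN; case: ifP => _ /=; rewrite fuN ?andbF.
Qed.

Lemma star_packing_colorable (V : finType) (e : rel V) (f : V -> nat) :
  symmetric e ->
  (forall v, star (f v) (map f (enum (e v))) && (f v \in colors)) ->
  packing_colorable e [:: 1; 2; 2; 2; 2; 2].
Proof.
move=> e_sym stf; have st v : star (f v) (map f (enum (e v))) by case/andP: (stf v).
have f6 v : f v < 6 by case/andP: (stf v); rewrite mem_iota.
have edge u v : e u v -> f v != f u.
  by move=> euv; apply: star_edge (st u) _; rewrite map_f // mem_enum.
have near u v w : e u w -> e w v -> u != v -> f u != 0 -> f v != f u.
  move=> euw ewv uv fu0; apply: (star_distinct _ (st w)) => //; first exact: enum_uniq.
    by rewrite mem_enum (_ : (u \in e w) = e w u) // e_sym.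
  by rewrite mem_enum.
exists (fun i : 'I_6 => [set v | f v == i]); split=> [v|i u v].
  exists (Ordinal (f6 v)); split; first by rewrite inE.
  by move=> i; rewrite inE => /eqP fvi; apply: val_inj.
rewrite !inE => /eqP fu /eqP fv uv d [[p [pp lp <-]] _].
have {}uv : u != v by apply/eqP.
have fuv : f v == f u by rewrite fu fv.
case: p pp lp => [_ /= uvE|w [|z [|? p]]] /=; first by rewrite uvE eqxx in uv.
- by move=> /andP[euw _] wv; rewrite -wv (negPf (edge _ _ euw)) in fuv.
- case/and3P=> euw ewz _ zv; have [f0|f0] := eqVneq (f u) 0.
    by rewrite -fu f0.
  by rewrite zv in ewz; rewrite (negPf (near _ _ _ euw ewz uv f0)) in fuv.
- by move=> _ _; case: (i) => [[|[|[|[|[|[|]]]]]]].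
Qed.

Theorem theorem3p2 (R : realType) (V : finType) (e : rel V) :
  simple_graph e -> cubic e -> halin R e ->
  packing_colorable e [:: 1; 2; 2; 2; 2; 2].
Proof.
move=> [e_sym e_irr] e_cubic.
move=> [t [s [[tree_t _ _] [uniq_s s3 s_leaves] eE [p [A drawing]]]]].
have [alpha [T turning]] := drawing_turning_system drawing.
case: s s3 uniq_s s_leaves eE => // p0 s' _ uniq_s s_leaves eE.
have cvx q x : t q x -> ~~ branch t q x p0 -> convex (branch t q x) (p0 :: s').
  move=> tqx p0B s1 a s2 b s3 c s4 sE Ba Bc; apply/negPn/negP => nBb.
  case: s1 sE => [|z s1] sE; first by case: sE Ba p0B => -> _ ->.
  case: sE => _ s'E; rewrite s'E in uniq_s s_leaves eE.
  exact: (no_crossing tree_t uniq_s s_leaves eE turning tqx erefl Ba Bc nBb p0B).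
have [f stf] :=
  halin_star_coloring tree_t uniq_s s_leaves eE e_irr e_cubic erefl cvx.
exact: star_packing_colorable e_sym stf.
Qed.
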